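(* There exists a consistent atomic RCC8 network over $\{\mathbf{DC},\mathbf{TPP},\mathbf{TPP}^{-1}\}$ which has no convex solution in $\mathbb{R}$.
   Context: A region in $\mathbb{R}^n$ ($n\geq 1$) is a nonempty regular closed subset $X$, i.e. $X=\mathrm{cl}(\mathrm{int}(X))$; write $i(X)$ for the interior. The eight RCC8 base relations between regions $a,b$ (jointly exhaustive and pairwise disjoint; $\subset$ denotes proper inclusion) are: $a\,\mathbf{EQ}\,b$: $a=b$; $a\,\mathbf{DC}\,b$: $a\cap b=\emptyset$; $a\,\mathbf{EC}\,b$: $a\cap b\neq\emptyset$ and $i(a)\cap i(b)=\emptyset$; $a\,\mathbf{PO}\,b$: $i(a)\cap i(b)\neq\emptyset$, $a\not\subseteq b$, $b\not\subseteq a$; $a\,\mathbf{TPP}\,b$: $a\subset b$ and $a\not\subset i(b)$; $a\,\mathbf{NTPP}\,b$: $a\subset i(b)$; and the converses $\mathbf{TPP}^{-1}$, $\mathbf{NTPP}^{-1}$ of the last two. Let $V$ be a finite set of variables. An RCC8 constraint is an expression $u\,R\,v$ with $u,v\in V$ and $R$ a nonempty set of base relations; an RCC8 network is a set of such constraints. It is atomic if for every pair of distinct variables $u,v$ it contains a constraint $u\,R\,v$ or $v\,R\,u$ with $R$ a singleton. It is a network over a set $\mathcal{R}$ of base relations if every constraint $u\,R\,v$ in it has $R\subseteq\mathcal{R}$. An $n$-dimensional solution (solution in $\mathbb{R}^n$) of a network is a map $\mathcal{S}$ from $V$ to regions of $\mathbb{R}^n$ such that for each constraint $u\,R\,v$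 the base relation holding between $\mathcal{S}(u)$ and $\mathcal{S}(v)$ belongs to $R$. A network is consistent if it has a solution in $\mathbb{R}^n$ for some $n\geq 1$ (the regions need not be convex or connected). A solution is convex if every $\mathcal{S}(v)$ is a convex set. *)

(* Defs.v *)
(* MathComp-Analysis *)
From mathcomp Require Import all_boot all_order all_algebra.
From mathcomp Require Import all_classical all_reals all_analysis.
Set Implicit Arguments.
Unset Strict Implicit.
Unset Printing Implicit Defensive.
Import numFieldNormedType.Exports.
Local Open Scope classical_set_scope.
Local Open Scope ring_scope.

(* R^n is 'rV[R]_n with its product (equivalently, Euclidean) topology. *)
Definition region (R : realType) (n : nat) (X : set 'rV[R]_n) : Prop :=
  X !=set0 /\ regclosed X.

Inductive rcc8 : Type :=
  EQ | DC | EC | PO | TPP | NTPP | TPPi | NTPPi.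

(* [A `<` B] is proper inclusion. *)
Definition rcc8_holds (R : realType) (n : nat) (r : rcc8)
    (a b : set 'rV[R]_n) : Prop :=
  match r with
  | EQ => a = b
  | DC => a `&` b = set0
  | EC => a `&` b !=set0 /\ a° `&` b° = set0
  | PO => [/\ a° `&` b° !=set0, ~ (a `<=` b) & ~ (b `<=` a)]
  | TPP => a `<` b /\ ~ (a `<` b°)
  | NTPP => a `<` b°
  | TPPi => b `<` a /\ ~ (b `<` a°)
  | NTPPi => b `<` a°
  end.

Record rcc8_constraint (V : finType) := RCC8Constraint {
  rcc8_fst : V;
  rcc8_rel : set rcc8;
  rcc8_snd : V;
  rcc8_rel_nonempty : rcc8_rel !=set0 }.

Definition rcc8_network (V : finType) := set (rcc8_constraint V).

Definition atomic_network (V : finType) (N : rcc8_network V) : Prop :=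
  forall u v : V, u <> v ->
    exists2 c : rcc8_constraint V, N c &
      ((rcc8_fst c = u /\ rcc8_snd c = v) \/
       (rcc8_fst c = v /\ rcc8_snd c = u)) /\
      exists r : rcc8, rcc8_rel c = [set r].

Definition network_over (V : finType) (B : set rcc8) (N : rcc8_network V)
    : Prop :=
  forall c : rcc8_constraint V, N c -> rcc8_rel c `<=` B.

(* Exactly one base relation holds between two given regions, so "the base
   relation between the two images belongs to the set" is rendered by the
   existence of a member of the set that holds. *)
Definition solution (R : realType) (n : nat) (V : finType)
    (N : rcc8_network V) (S : V -> set 'rV[R]_n) : Prop :=
  (forall v : V, region (S v)) /\
  (forall c : rcc8_constraint V, N c ->
     exists2 r : rcc8, rcc8_rel c r &
       rcc8_holds r (S (rcc8_fst c)) (S (rcc8_snd c))).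

Definition consistent (R : realType) (V : finType) (N : rcc8_network V)
    : Prop :=
  exists2 n : nat, (1 <= n)%N &
    exists S : V -> set 'rV[R]_n, solution N S.

Definition convex_solution (R : realType) (n : nat) (V : finType)
    (N : rcc8_network V) (S : V -> set 'rV[R]_n) : Prop :=
  solution N S /\ forall v : V, convex_set (S v).

(* Main.v *)
(* Three pairwise disjoint tangential proper parts of one region each contain a
   non-interior point of it.  A convex subset of the line has at most two such
   points, since a point strictly between two others is interior; whereas the
   union of three disjoint segments has the three segments as tangential
   proper parts. *)
Require Import Defs.
From mathcomp Require Import all_boot all_order all_algebra.
From mathcomp Require Import all_classical all_reals all_analysis.
From mathcomp Require Import ring lra.
Import numFieldNormedType.Exports.
Import Order.TTheory GRing.Theory Num.Theory.
Local Open Scope classical_set_scope.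
Local Open Scope ring_scope.

Lemma regclosed_closed (T : topologicalType) (A : set T) :
  regclosed A -> closed A.
Proof. by move=> <-; exact: closed_closure. Qed.

(** [TPP] denies only proper inclusion in [B°], so the case [A = B°] must be excluded: since [A] is
    closed, [B° ⊆ A] would give [B = cl(B°) ⊆ A], against [A] being a proper part of [B]. *)
Lemma tpp_not_interior (R : realType) (n : nat) (A B : set 'rV[R]_n) :
  regclosed A -> regclosed B -> rcc8_holds TPP A B ->
  exists2 p, A p & ~ B° p.
Proof.
move=> /regclosed_closed clA rB [[AB nBA] nAB].
apply: contrapT => nex; apply: nAB; split.
  by move=> p Ap; apply: contrapT => nBp; apply: nex; exists p.
move=> BA; apply: nBA.
by rewrite -rB ((closure_id A).1 clA); exact: closureS.
Qed.

Lemma rV1_eq (R : realType) (u v : 'rV[R]_1) : u 0 0 = v 0 0 -> u = v.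
Proof. by move=> uv; apply/rowP => i; rewrite ord1. Qed.

Lemma open_segment (R : realType) (a b : R) :
  open [set v : 'rV[R]_1 | a < v 0 0 < b].
Proof.
rewrite (_ : [set _ | _] = (fun v : 'rV[R]_1 => v 0 0) @^-1` `]a, b[).
  apply: open_comp; last exact: interval_open.
  by move=> v _; exact: coord_continuous.
by apply/seteqP; split=> v /=; rewrite in_itv.
Qed.

Lemma closed_segment (R : realType) (a b : R) :
  closed [set v : 'rV[R]_1 | a <= v 0 0 <= b].
Proof.
rewrite (_ : [set _ | _] = (fun v : 'rV[R]_1 => v 0 0) @^-1` `[a, b]).
  apply: preimage_closed; last exact: interval_closed.
  by move=> v _; exact: coord_continuous.
by apply/seteqP; split=> v /=; rewrite in_itv.
Qed.

Lemma convex_between_interior (R : realType) (X : set 'rV[R]_1)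
    (p q r : 'rV[R]_1) :
  convex_set X -> X p -> X r -> p 0 0 < q 0 0 < r 0 0 -> X° q.
Proof.
move=> cX Xp Xr pqr; rewrite /interior /=.
suff sub : [set v : 'rV[R]_1 | p 0 0 < v 0 0 < r 0 0] `<=` X.
  apply: (filterS sub); apply: open_nbhs_nbhs.
  by split=> //; exact: open_segment.
move=> v /= /andP[pv vr].
have pr : 0 < r 0 0 - p 0 0 by lra.
(* The weight of [p] when [v] is written as [l p + (1 - l) r]. *)
pose l := (r 0 0 - v 0 0) / (r 0 0 - p 0 0).
have l0 : 0 <= l by rewrite divr_ge0; lra.
have l1 : l <= 1 by rewrite ler_pdivrMr; lra.
have := cX p r (Itv01 l0 l1); rewrite !inE => /(_ Xp Xr).
suff -> : conv (Itv01 l0 l1) (p : convex_lmodType _) (r : convex_lmodType _) = v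
  by [].
change (l *: p + (1 - l) *: r = v); apply: rV1_eq.
by rewrite !mxE /l; field; lra.
Qed.

(** Serves both to push an endpoint of a segment inwards, for regularity, and to leave a union of
    segments through an endpoint, for tangency. *)
Lemma nbhs_line (R : realType) (n : nat) (v w : 'rV[R]_n) (B : set 'rV[R]_n) :
  nbhs v B -> \forall t \near 0^'+, B (v + t *: w).
Proof.
move=> Bv; suff : (v + t *: w) @[t --> (0:R)^'+] --> v by apply.
apply: cvg_at_right_filter.
rewrite -[X in _ --> X]addr0 -(scale0r w).
by apply: cvgD; [exact: cvg_cst | apply: cvgZr_tmp; exact: cvg_id].
Qed.

Lemma segment_regclosed (R : realType) (a b : R) :
  a < b -> regclosed [set v : 'rV[R]_1 | a <= v 0 0 <= b].
Proof.
move=> ab; apply/seteqP; split.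
  rewrite [X in _ `<=` X](closure_id _).1; last exact: closed_segment.
  by apply: closureS; exact: interior_subset.
move=> v /= /andP[av vb] B Bv.
(* The direction from [v] to the midpoint: for [0 < t < 1] the point [v + t w] is strictly between
   [a] and [b], even when [v] is an endpoint. *)
pose w : 'rV[R]_1 := const_mx ((a + b) / 2 - v 0 0).
near (0:R)^'+ => t.
exists (v + t *: w); split; last by near: t; exact: nbhs_line.
have sub : [set v : 'rV[R]_1 | a < v 0 0 < b]
    `<=` [set v : 'rV[R]_1 | a <= v 0 0 <= b].
  by move=> u /= /andP[/ltW -> /ltW ->].
apply: (filterS sub); apply: open_nbhs_nbhs; split; first exact: open_segment.
have t0 : 0 < t by near: t; exact: nbhs_right_gt.
have t1 : t < 1 by near: t; exact: nbhs_right_lt.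
by rewrite /= !mxE; apply/andP; split; nra.
Unshelve. all: by end_near. Qed.

(** [None] is the whole and each [Some i] one of its parts. The value [DC] on the diagonal is a
    dummy, as [star_network] keeps only pairs of distinct variables. *)
Definition star_rel (I : eqType) (u v : option I) : rcc8 :=
  match u, v with
  | Some _, None => TPP
  | None, Some _ => TPPi
  | _, _ => DC
  end.

Definition star_constraint (I : finType) (u v : option I) :
    rcc8_constraint (option I) :=
  @RCC8Constraint (option I) u [set star_rel I u v] v
    (ex_intro _ (star_rel I u v) erefl).

Definition star_network (I : finType) : rcc8_network (option I) :=
  [set c | exists2 p : option I * option I,
     p.1 <> p.2 & c = star_constraint I p.1 p.2].

Lemma star_network_atomic (I : finType) :
  atomic_network (star_network I).
Proof.
move=> u v uv; exists (star_constraint I u v); first by exists (u, v).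
by split; [left | exists (star_rel I u v)].
Qed.

Lemma star_network_over (I : finType) :
  network_over [set DC; TPP; TPPi] (star_network I).
Proof.
by move=> _ [[[i|] [j|]] _ ->] r -> /=; [left; left|left; right|right|left; left].
Qed.

Lemma star_network_solution (R : realType) (n : nat) (I : finType)
    (S : option I -> set 'rV[R]_n) :
  solution (star_network I) S <->
  [/\ forall v, region (S v),
      forall i, rcc8_holds TPP (S (Some i)) (S None)
    & forall i j, i <> j -> S (Some i) `&` S (Some j) = set0].
Proof.
split=> [[rS hS]|[rS tS dS]].
  split=> // [i|i j ij].
    have [|_ -> //] := hS (star_constraint I (Some i) None).
    by exists (Some i, None).
  have [|_ -> //] := hS (star_constraint I (Some i) (Some j)).
  by exists (Some i, Some j) => // -[].
split=> // _ [[u v] /= uv ->]; exists (star_rel I u v) => //=.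
move: u v uv => [i|] [j|] //= uv; first by apply: dS => ij; apply: uv; rewrite ij.
- exact: (tS i).
(* [TPPi] unfolds to [TPP] with the regions exchanged. *)
- exact: (tS j).
Qed.

Lemma star_network_not_convex (R : realType)
    (S : option 'I_3 -> set 'rV[R]_1) :
  ~ convex_solution (star_network 'I_3) S.
Proof.
move=> [/star_network_solution[rS tS dS] cS].
have bd i : exists2 p, S (Some i) p & ~ (S None)° p.
  exact: tpp_not_interior (rS _).2 (rS _).2 (tS i).
have SX i : S (Some i) `<=` S None by have [[]] := tS i.
pose i0 : 'I_3 := inord 0; pose i1 : 'I_3 := inord 1; pose i2 : 'I_3 := inord 2.
have neq i j (p q : 'rV[R]_1) : i <> j -> S (Some i) p -> S (Some j) q ->
    p 0 0 != q 0 0.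
  move=> ij Sp Sq; apply/eqP => /rV1_eq pq.
  have : (S (Some i) `&` S (Some j)) p by split; rewrite // pq.
  by rewrite dS.
have [p Sp np] := bd i0; have [q Sq nq] := bd i1; have [r Sr nr] := bd i2.
have pq : p 0 0 != q 0 0.
  by apply: neq Sp Sq => /(congr1 val); rewrite /= !inordK.
have qr : q 0 0 != r 0 0.
  by apply: neq Sq Sr => /(congr1 val); rewrite /= !inordK.
have pr : p 0 0 != r 0 0.
  by apply: neq Sp Sr => /(congr1 val); rewrite /= !inordK.
have between := convex_between_interior R _ _ _ _ (cS None).
have {Sp Sq Sr} [Sp Sq Sr] := And3 (SX _ _ Sp) (SX _ _ Sq) (SX _ _ Sr).
(* In every sign pattern one of the three points lies strictly between the other two, hence is
   interior to [S None], against its choice. *)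
case: (ltgtP (p 0 0) (q 0 0)) pq => // pq _;
  case: (ltgtP (q 0 0) (r 0 0)) qr => // qr _;
  case: (ltgtP (p 0 0) (r 0 0)) pr => // pr _.
all: try by apply: nq; apply: (between p q r) => //; rewrite pq qr.
all: try by apply: nq; apply: (between r q p) => //; rewrite pq qr.
all: try by apply: np; apply: (between q p r) => //; rewrite pq pr.
all: try by apply: np; apply: (between r p q) => //; rewrite pq pr.
all: try by apply: nr; apply: (between p r q) => //; rewrite pr qr.
all: try by apply: nr; apply: (between q r p) => //; rewrite pr qr.
Qed.

(** The segments [[2i, 2i + 1]] are separated by gaps of length 1, so the points just left of [2i]
    belong to none of them. *)
Definition even_segment (R : realType) (i : nat) : set 'rV[R]_1 :=
  [set v | i.*2%:R <= v 0 0 <= i.*2%:R + 1].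

Lemma even_segment_regclosed (R : realType) (i : nat) :
  regclosed (even_segment R i).
Proof. by apply: segment_regclosed; rewrite ltrDl. Qed.

Lemma even_segment_disjoint (R : realType) (i j : nat) :
  i <> j -> even_segment R i `&` even_segment R j = set0.
Proof.
move=> ij; wlog lij : i j ij / (i < j)%N.
  move=> W; have [/W->//|/W|//] := ltngtP i j; rewrite setIC => -> //.
  exact/nesym.
apply/seteqP; split=> // v [/= /andP[_ vi] /andP[jv _]].
have : i.*2%:R + 2 <= j.*2%:R :> R.
    by rewrite -natrD ler_nat addn2 -doubleS leq_double.
by lra.
Qed.

Lemma even_segment_left_notin (R : realType) (i j : nat) (t : R) :
  0 < t < 1 -> ~ even_segment R j (const_mx (i.*2%:R - t)).
Proof.
move=> /andP[t0 t1]; rewrite /even_segment /= mxE => /andP[jt tj].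
have [ij|ji] := leqP i j.
  have : i.*2%:R <= j.*2%:R :> R by rewrite ler_nat leq_double.
  by lra.
have : j.*2%:R + 2 <= i.*2%:R :> R.
    by rewrite -natrD ler_nat addn2 -doubleS leq_double.
by lra.
Qed.

Definition star_segments (R : realType) (u : option 'I_3) : set 'rV[R]_1 :=
  if u is Some i then even_segment R i
  else \bigcup_(i : 'I_3) even_segment R i.

Lemma star_segments_solution (R : realType) :
  solution (star_network 'I_3) (star_segments R).
Proof.
have left_end i : even_segment R i (const_mx i.*2%:R).
  by rewrite /even_segment /= mxE lexx lerDl /=.
have sub (i : 'I_3) : even_segment R i `<=` \bigcup_(i : 'I_3) even_segment R i.
  by move=> v vi; exists i.
apply/star_network_solution; split.
- move=> [i|]; split.
  + by exists (const_mx i.*2%:R); exact: left_end.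
  + exact: even_segment_regclosed.
  + by exists (const_mx (ord0 : 'I_3).*2%:R); exists ord0 => //; exact: left_end.
  + apply/seteqP; split.
      rewrite [X in _ `<=` X](closure_id _).1.
        by apply: closureS; exact: interior_subset.
      apply: closed_bigcup; first exact: finite_finset.
      by move=> i _; apply: regclosed_closed; exact: even_segment_regclosed.
    (* Each segment is the closure of its interior, and that interior lies in the interior of the
       union. *)
    move=> v [i _]; rewrite -even_segment_regclosed; apply: closureS.
    exact: interiorS.
- move=> i; split.
    split; first exact: sub.
    (* [lift i ord0] is merely some index other than [i]; the left end of its segment is in the
       union but not in segment [i]. *)
    move=> /(_ (const_mx (lift i ord0).*2%:R)) nsub.
    have ij : i <> lift i ord0 :> nat.
      by move=> /val_inj /eqP; rewrite (negbTE (neq_lift _ _)).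
    have : (even_segment R i `&` even_segment R (lift i ord0))
        (const_mx (lift i ord0).*2%:R).
      by split; [apply: nsub; exists (lift i ord0) | exact: left_end].
    by rewrite even_segment_disjoint.
  (* The left end [2i] is not interior to the union: the points [2i - t] with small [t > 0] fall in
     a gap. *)
  move=> [sub_int _]; have := sub_int _ (left_end i).
  move=> /(nbhs_line _ _ _ (const_mx (-1))) near_union.
  near (0:R)^'+ => t.
  have : (\bigcup_(i : 'I_3) even_segment R i)
      (const_mx i.*2%:R + t *: const_mx (-1)) by near: t.
  have -> : const_mx i.*2%:R + t *: const_mx (-1) =
      const_mx (i.*2%:R - t) :> 'rV[R]_1.
    by apply: rV1_eq; rewrite !mxE mulrN1.
  move=> [j _]; apply: even_segment_left_notin; apply/andP; split.
    by near: t; exact: nbhs_right_gt.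
  by near: t; exact: nbhs_right_lt.
- by move=> i j ij; apply: even_segment_disjoint => /val_inj.
Unshelve. all: by end_near. Qed.

Theorem proposition4 (R : realType) :
  exists (V : finType) (N : rcc8_network V),
    [/\ consistent R N,
        atomic_network N,
        network_over [set DC; TPP; TPPi] N
      & ~ exists S : V -> set 'rV[R]_1, convex_solution N S].
Proof.
exists (option 'I_3), (star_network 'I_3); split.
(* Dimension 1 already suffices for consistency, with a disconnected region for [None]. *)
- by exists 1%N => //; exists (star_segments R); exact: star_segments_solution.
- exact: star_network_atomic.
- exact: star_network_over.
- by move=> [S]; exact: star_network_not_convex.
Qed.
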